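(* Let $s\ge1$, let $d_1,\ldots,d_s$ be positive integers, put $K=\sum_{i=1}^{s}d_i(d_i+1)$ and $D_i=\binom{d_i+1}{2}$, and let $H=(V,E_H)$ and $F=(V,E_F)$ be edge-disjoint graphs on the same $n$-vertex set $V$. If the graph $G=H\cup F=(V,E_H\cup E_F)$ is $K$-connected, then $$|E_F|+\sum_{i=1}^{s}r_{d_i}(H)\ \ge\ \sum_{i=1}^{s}(d_i n-D_i).$$
   Context: All graphs are finite and simple. For a positive integer $k$, a graph $G$ is $k$-connected if $|V(G)|\ge k+1$ and $G-S$ is connected for every $S\subseteq V(G)$ with $|S|<k$. Rigidity: let $K(V)$ be the complete graph on a finite vertex set $V$. A $d$-dimensional realization is a map $p:V\to\mathbb{R}^d$; it is generic if its $d|V|$ coordinates are algebraically independent over $\mathbb{Q}$. The rigidity matrix $R(G,p)$ of a graph $G$ on $V$ has one row for each edge $uv$ and $d$ columns for each vertex; the row of $uv$ has $p(u)-p(v)$ in the columns of $u$, $p(v)-p(u)$ in the columns of $v$, and zeros elsewhere. The $d$-dimensional generic rigidity matroid $\mathcal{R}_d(K(V))$ is the row matroid of $R(K(V),p)$ for generic $p$ (independent of the choice of generic $p$), and $r_d$ denotes its rank function. For a graph $H=(V,E_H)$ put $r_d(H)=r_d(E_H)$. *)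

(* Defs.v *)
From HB Require Import structures.
From mathcomp Require Import all_boot all_order all_algebra.
From mathcomp Require Import boolp classical_sets reals.
From mathcomp Require Import mpoly.

Set Implicit Arguments.
Unset Strict Implicit.
Unset Printing Implicit Defensive.

Import Order.TTheory GRing.Theory Num.Theory.

Local Open Scope ring_scope.

(* A graph on the vertex set V is given by its edge set, an edge being an
   unordered pair of distinct vertices. *)
Definition simple_graph (V : finType) (E : {set {set V}}) : Prop :=
  forall e, e \in E -> #|e| = 2.

Definition adj_avoiding (V : finType) (E : {set {set V}}) (S : {set V}) :
    rel V :=
  [rel u v | [&& u \notin S, v \notin S & [set u; v] \in E]].

Definition connected_minus (V : finType) (E : {set {set V}}) (S : {set V}) :
    Prop :=
  forall u v, u \notin S -> v \notin S -> connect (adj_avoiding E S) u v.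

Definition k_connected (V : finType) (k : nat) (E : {set {set V}}) : Prop :=
  (k.+1 <= #|V|)%N /\
  forall S : {set V}, (#|S| < k)%N -> connected_minus E S.

Definition alg_indep_rat (R : realType) (N : nat) (x : 'I_N -> R) : Prop :=
  forall q : {mpoly rat[N]}, mmap (@ratr R) x q = 0 -> q = 0.

(* The column of the rigidity matrix with index j belongs to the vertex
   col_vertex j and to the coordinate col_coord j. *)
Definition col_vertex (V : finType) (d : nat) (j : 'I_#|{: V * 'I_d}|) : V :=
  (enum_val j).1.

Definition col_coord (V : finType) (d : nat) (j : 'I_#|{: V * 'I_d}|) : 'I_d :=
  (enum_val j).2.

Definition coords (R : realType) (V : finType) (d : nat) (p : V -> 'rV[R]_d)
    (j : 'I_#|{: V * 'I_d}|) : R :=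
  p (col_vertex j) 0 (col_coord j).

Definition generic (R : realType) (V : finType) (d : nat)
    (p : V -> 'rV[R]_d) : Prop :=
  alg_indep_rat (coords p).

(* For an edge e = {u, v} and w = u the sum below is
   (p u - p u) + (p u - p v) = p u - p v. *)
Definition rigidity_row (R : realType) (V : finType) (d : nat)
    (p : V -> 'rV[R]_d) (e : {set V}) (w : V) : 'rV[R]_d :=
  if w \in e then \sum_(x in e) (p w - p x) else 0.

Definition rigidity_mx (R : realType) (V : finType) (d : nat)
    (p : V -> 'rV[R]_d) (E : {set {set V}}) :
    'M[R]_(#|E|, #|{: V * 'I_d}|) :=
  \matrix_(i, j) rigidity_row p (enum_val i) (col_vertex j) 0 (col_coord j).

Lemma poly_finite_roots (R : realType) (P : {poly R}) :
  P != 0 -> exists s : seq R, forall x, root P x -> x \in s.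
Proof.
move: {2}(size P) (leqnn (size P)) => n.
elim: n P => [|n IHn] P; first by rewrite leqn0 size_poly_eq0 => /eqP->; rewrite eqxx.
move=> sP P0; have [[x Px]|noroot] := pselect (exists x, root P x); last first.
  by exists [::] => x Px; case: noroot; exists x.
have /factor_theorem [Q PE] := Px.
have Q0 : Q != 0 by apply: contraNneq P0 => Q0; rewrite PE Q0 mul0r.
have szQ : (size Q <= n)%N.
  by move: sP; rewrite PE size_Mmonic ?monicXsubC // size_XsubC addn2.
have [s sQ] := IHn Q szQ Q0.
exists (x :: s) => y; rewrite PE rootM root_XsubC inE => /orP[/sQ->|->//].
by rewrite orbT.
Qed.

Lemma real_avoid_seq (R : realType) (f : nat -> R) : exists x, forall n, x != f n.
Proof.
(* nested intervals: step keeps an outer third that avoids f n *)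
pose step (ab : R * R) (y : R) : R * R :=
  let m1 := ab.1 + (ab.2 - ab.1) / 3%:R in
  let m2 := ab.1 + (ab.2 - ab.1) / 3%:R *+ 2 in
  if y < m2 then (m2, ab.2) else (ab.1, m1).
pose I := fix I n := if n is k.+1 then step (I k) (f k) else (0, 1) : R * R.
have third (ab : R * R) : ab.1 < ab.2 -> 0 < (ab.2 - ab.1) / 3%:R.
  by move=> h; rewrite divr_gt0 ?subr_gt0 // ltr0n.
have thirdE (ab : R * R) : ab.2 = ab.1 + (ab.2 - ab.1) / 3%:R *+ 3.
  by rewrite -mulr_natr divfK ?pnatr_eq0 // addrC subrK.
have stepP ab y : ab.1 < ab.2 ->
    [/\ ab.1 <= (step ab y).1, (step ab y).1 < (step ab y).2,
        (step ab y).2 <= ab.2 & ~~ ((step ab y).1 <= y <= (step ab y).2)].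
  move=> h; have t0 := third _ h; have e := thirdE ab.
  rewrite /step; move: e t0; set t := (_ / _) => e t0.
  have l12 : ab.1 + t < ab.1 + t *+ 2 by rewrite ltrD2l mulr2n ltrDl.
  have l23 : ab.1 + t *+ 2 < ab.2 by rewrite e ltrD2l mulrS ltrDr.
  case: ltP => hy /=; split=> //.
  - by rewrite lerDl mulrn_wge0 ?ltW.
  - by rewrite negb_and -!ltNge hy.
  - by rewrite ltrDl.
  - exact: ltW (lt_trans l12 l23).
  - by rewrite negb_and -!ltNge (lt_le_trans l12 hy) orbT.
have Ilt n : (I n).1 < (I n).2.
  by elim: n => [|n IH]; [rewrite /= ltr01|case: (stepP _ (f n) IH)].
have Imono m n : (m <= n)%N -> (I m).1 <= (I n).1 /\ (I n).2 <= (I m).2.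
  elim: n => [|n IH]; first by rewrite leqn0 => /eqP->.
  rewrite leq_eqVlt => /predU1P[->//|/IH[h1 h2]].
  have [s1 _ s2 _] := stepP _ (f n) (Ilt n).
  by split; [apply: le_trans h1 s1|apply: le_trans s2 h2].
have Icross m n : (I m).1 <= (I n).2.
  have [h1 _] := Imono _ _ (leq_maxl m n); have [_ h2] := Imono _ _ (leq_maxr m n).
  exact: le_trans h1 (le_trans (ltW (Ilt _)) h2).
pose A : set R := [set x | exists n, x = (I n).1]%classic.
have ub n : ubound A (I n).2 by move=> _ [m ->].
exists (sup A) => n; have [_ _ _] := stepP _ (f n) (Ilt n).
rewrite -[step _ _]/(I n.+1); apply: contraNneq => <-; apply/andP; split.
  have Ab : has_ubound A by exists (I 0).2; apply: ub.
  by apply: (ub_le_sup Ab); exists n.+1.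
by apply: (ge_sup _ (ub n.+1)); exists (I 0).1, 0%N.
Qed.

Lemma avoid_roots (R : realType) (T : countType) (P : T -> {poly R}) :
  exists x, forall t, P t != 0 -> ~~ root (P t) x.
Proof.
have /choice[s sP] t : exists s : seq R, P t != 0 -> forall x, root (P t) x -> x \in s.
  have [->|P0] := eqVneq (P t) 0; first by exists [::].
  by have [s h] := poly_finite_roots P0; exists s.
pose f n := if (unpickle n : option (T * nat)) is Some (t, i)
            then nth 0 (s t) i else 0.
have [x xf] := real_avoid_seq f.
exists x => t P0; apply/negP => /(sP _ P0) xs.
have := xf (pickle (t, index x (s t))).
by rewrite /f pickleK nth_index // eqxx.
Qed.

Definition mpoly_code N (q : {mpoly rat[N]}) : seq ('X_{1..N} * rat) :=
  [seq (m, q@_m) | m <- msupp q].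

Definition mpoly_decode N (s : seq ('X_{1..N} * rat)) : {mpoly rat[N]} :=
  \sum_(c <- s) c.2 *: 'X_[c.1].

Lemma mpoly_codeK N : cancel (@mpoly_code N) (@mpoly_decode N).
Proof. by move=> q; rewrite /mpoly_decode big_map /= -mpolyE. Qed.

Lemma alg_indep_rat_exists (R : realType) N :
  exists x : 'I_N -> R, alg_indep_rat x.
Proof.
elim: N => [|N [v vP]].
  exists (fun=> 0) => q; rewrite [q]nvar0_mpolyC mmapC => /eqP.
  by rewrite fmorph_eq0 => /eqP->; rewrite mpolyC0.
pose wd := widen_ord (leqnSn N).
pose lo (m : 'X_{1..N.+1}) : 'X_{1..N} := [multinom m (wd i) | i < N].
(* q with the first N variables specialized to v *)
pose P (q : {mpoly rat[N.+1]}) : {poly R} :=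
  \sum_(m <- msupp q) (ratr q@_m * mmap1 v (lo m)) *: 'X^(m ord_max).
have P0 q : P q = 0 -> q = 0.
  move=> Pq; apply/mpolyP => m; rewrite mcoeff0.
  pose qk := \sum_(m' <- msupp q | m' ord_max == m ord_max)
               q@_m' *: 'X_[lo m'] : {mpoly rat[N]}.
  have qk0 : qk = 0.
    apply: vP; rewrite raddf_sum /=.
    have := congr1 (fun p : {poly R} => p`_(m ord_max)) Pq.
    rewrite coef0 coef_sum => e; rewrite -[RHS]e [LHS]big_mkcond /=.
    apply: eq_bigr => m' _; rewrite coefZ coefXn eq_sym.
    by case: eqP => _; rewrite ?mulr0 // mulr1 mmapZ mmapX.
  have := congr1 (fun p => p@_(lo m)) qk0.
  rewrite mcoeff0 raddf_sum /= => e; apply/eqP/negPn/negP => qm.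
  move: e; rewrite big_mkcond (bigD1_seq m) ?msupp_uniq ?mcoeff_msupp //= eqxx.
  rewrite mcoeffZ mcoeffX eqxx mulr1 big1 ?addr0 => [/eqP|m' nm].
    by rewrite (negPf qm).
  case: ifP => // em.
  rewrite mcoeffZ mcoeffX; case: eqP => [lom|_]; last by rewrite mulr0.
  case/eqP: nm; apply/mnmP => i; have [j ->|->] := unliftP ord_max i.
    have -> : lift ord_max j = wd j by apply: val_inj; rewrite /= /bump leqNgt ltn_ord.
    by move/mnmP/(_ j): lom; rewrite !mnmE.
  exact/eqP.
have [x xP] := avoid_roots (fun s : seq ('X_{1..N.+1} * rat) => P (mpoly_decode s)).
exists (fun i => if unlift ord_max i is Some j then v j else x) => q qx.
apply/eqP/negPn/negP => q0.
have /xP : P (mpoly_decode (mpoly_code q)) != 0.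
  by rewrite mpoly_codeK; apply: contraNneq q0 => /P0->.
rewrite mpoly_codeK => /negP; apply; apply/rootP; rewrite -[RHS]qx.
rewrite horner_sum; apply: eq_bigr => m _.
rewrite hornerZ hornerXn -mulrA; congr (_ * _).
rewrite /mmap1 big_ord_recr /= unlift_none; congr (_ * _).
apply: eq_bigr => i _; rewrite mnmE -/wd.
have -> : wd i = lift ord_max i by apply: val_inj; rewrite /= /bump leqNgt ltn_ord.
by rewrite liftK.
Qed.

Lemma generic_exists (R : realType) (V : finType) (d : nat) :
  exists p : V -> 'rV[R]_d, generic p.
Proof.
have [x xP] := @alg_indep_rat_exists R #|{: V * 'I_d}|.
exists (fun u => \row_k x (enum_rank (u, k))) => q.
suff -> : coords (fun u => \row_k x (enum_rank (u, k))) = x by apply: xP.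
apply/funext => j; rewrite /coords mxE /col_vertex /col_coord.
by rewrite -surjective_pairing enum_valK.
Qed.

(* The rank of the rows E in the row matroid of the rigidity matrix of the
   complete graph, for a chosen generic realization; rigidity_rankE shows that
   the choice is irrelevant. *)
Definition rigidity_rank (R : realType) (V : finType) (d : nat)
    (E : {set {set V}}) : nat :=
  \rank (rigidity_mx (projT1 (cid (generic_exists R V d))) E).

Lemma leq_rank_map_mx (A : idomainType) (F : fieldType) (f g : {rmorphism A -> F})
    m n (M : 'M[A]_(m, n)) :
  injective f -> injective g -> (\rank (map_mx f M) <= \rank (map_mx g M))%N.
Proof.
move=> fI gI; set r := \rank (map_mx f M).
have [h hr] : exists h : 'I_r -> 'I_m, \rank (rowsub h (map_mx f M)) = r.
  by exists (maxrankfun (map_mx f M)); apply/eqP; exact: maxrowsub_free.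
have [k kr] : exists k : 'I_r -> 'I_n, mxsub h k (map_mx f M) \in unitmx.
  have full : row_full (rowsub h (map_mx f M))^T by rewrite /row_full mxrank_tr hr.
  exists (fullrankfun full); rewrite -unitmx_tr -row_full_unit.
  have := fullrowsub_full full.
  by congr row_full; apply/matrixP => i j; rewrite !mxE.
have gu : mxsub h k (map_mx g M) \in unitmx.
  move: kr; rewrite -!map_mxsub !unitmxE !det_map_mx !unitfE.
  by rewrite !(raddf_eq0 _ _) //.
have /eqP gr : row_free (mxsub h k (map_mx g M)) by rewrite row_free_unit.
rewrite -[leqLHS]gr.
have -> : mxsub h k (map_mx g M) = rowsub h (colsub k (map_mx g M)).
  by apply/matrixP => i j; rewrite !mxE.
rewrite rowsubE; apply: leq_trans (mxrankM_maxr _ _) _.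
rewrite -mxrank_tr -[leqRHS]mxrank_tr.
have -> : (colsub k (map_mx g M))^T = rowsub k (map_mx g M)^T.
  by apply/matrixP => i j; rewrite !mxE.
by rewrite rowsubE; apply: mxrankM_maxr.
Qed.

Lemma rank_generic_unique (R : realType) (V : finType) (d : nat)
    (E : {set {set V}}) (p p' : V -> 'rV[R]_d) :
  generic p -> generic p' -> \rank (rigidity_mx p E) = \rank (rigidity_mx p' E).
Proof.
pose N := #|{: V * 'I_d}|.
pose X (w : V) (k : 'I_d) : {mpoly rat[N]} := 'X_(enum_rank (w, k)).
pose M : 'M[{mpoly rat[N]}]_(#|E|, N) := \matrix_(i, j)
  let e : {set V} := enum_val i in
  if col_vertex j \in e
  then \sum_(x in e) (X (col_vertex j) (col_coord j) - X x (col_coord j))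
  else 0.
pose ev (p : V -> 'rV[R]_d) : {rmorphism {mpoly rat[N]} -> R} :=
  mmap (@ratr R) (coords p).
have evX (p0 : V -> 'rV[R]_d) w k : ev p0 (X w k) = p0 w 0 k.
  by rewrite /ev /X /= mmapX mmap1U /coords /col_vertex /col_coord enum_rankK.
have MP (p0 : V -> 'rV[R]_d) : rigidity_mx p0 E = map_mx (ev p0) M.
  apply/matrixP => i j; rewrite !mxE /rigidity_row.
  case: ifP => _; last by rewrite mxE rmorph0.
  rewrite summxE rmorph_sum; apply: eq_bigr => x _.
  by rewrite !mxE rmorphB !evX.
have evI (p0 : V -> 'rV[R]_d) : generic p0 -> injective (ev p0).
  move=> gp; apply: raddf_inj => q; exact: gp.
move=> gp gp'; rewrite !MP; apply/eqP; rewrite eqn_leq.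
by rewrite !leq_rank_map_mx //; apply: evI.
Qed.

Lemma rigidity_rankE (R : realType) (V : finType) (d : nat)
    (E : {set {set V}}) (p : V -> 'rV[R]_d) :
  generic p -> rigidity_rank R d E = \rank (rigidity_mx p E).
Proof. by move=> gp; apply: rank_generic_unique gp; case: cid. Qed.

(* Main.v *)
Require Import Defs.
From mathcomp Require Import all_boot all_order all_algebra.
From mathcomp Require Import boolp reals.
From mathcomp Require Import mpoly.
From mathcomp Require Import ring lra zify.

(** Let [H_i] be the closure of [EH] in the [d_i]-dimensional generic rigidity
    matroid.  Build [H_i] one vertex at a time: by 0- and 1-extensions a new
    vertex [v] with set [N] of earlier neighbours raises the rank by
    [min(d_i, |N|)], and by [d_i + 1] if [|N| > d_i] and [N] is not a clique of
    the closed graph [H_i].  The expected gain of [v] over a uniformly random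
    vertex order is bounded below using that [H_i], being closed, contains [uw]
    whenever [u] and [w] are adjacent to all vertices of a [d_i]-clique: hence a
    non-clique [N] with [|N| > d_i] has at most one vertex whose removal leaves a
    clique.  With [K = sum d_i (d_i + 1)], the expected gains of [v] in all the
    [H_i] plus half its [EF]-degree add up to at least [sum d_i], unless [v]
    meets no edge of [EF] and all its neighbourhoods are cliques.  In that case
    [v] is simplicial in the union of [EF] and the intersection of the [H_i],
    so deleting it keeps [K]-connectivity and lowers the left-hand side by at
    least [sum d_i]; one concludes by induction. *)

Set Implicit Arguments.
Unset Strict Implicit.
Unset Printing Implicit Defensive.

Import Order.TTheory GRing.Theory Num.Theory.

Local Open Scope ring_scope.

(** * Ranks of rigidity matrices *)

(** A maximal minor that is nonzero under [f] is nonzero in [A], hence under [g]. As [f] is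
    arbitrary, a generic realization has at least the rank of any special one. *)
Lemma leq_rank_map_mx_inj (A : idomainType) (F : fieldType)
    (f g : {rmorphism A -> F}) m n (M : 'M[A]_(m, n)) :
  injective g -> (\rank (map_mx f M) <= \rank (map_mx g M))%N.
Proof.
move=> gI; set r := \rank (map_mx f M).
pose h : 'I_r -> 'I_m := maxrankfun (map_mx f M).
have full : row_full (rowsub h (map_mx f M))^T.
  by rewrite /row_full mxrank_tr; exact: (maxrowsub_free (map_mx f M)).
pose k : 'I_r -> 'I_n := fullrankfun full.
have kr : mxsub h k (map_mx f M) \in unitmx.
  rewrite -unitmx_tr -row_full_unit; have := fullrowsub_full full.
  by congr row_full; apply/matrixP => i j; rewrite !mxE.
have gu : mxsub h k (map_mx g M) \in unitmx.
  move: kr; rewrite -!map_mxsub !unitmxE !det_map_mx !unitfE (raddf_eq0 _ gI).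
  by apply: contra_neq => ->; rewrite rmorph0.
move: gu; rewrite -row_free_unit => /eqP <-.
have -> : mxsub h k (map_mx g M) = rowsub h (colsub k (map_mx g M)).
  by apply/matrixP => i j; rewrite !mxE.
rewrite rowsubE; apply: leq_trans (mxrankM_maxr _ _) _.
rewrite -mxrank_tr -[leqRHS]mxrank_tr.
have -> : (colsub k (map_mx g M))^T = rowsub k (map_mx g M)^T.
  by apply/matrixP => i j; rewrite !mxE.
by rewrite rowsubE; apply: mxrankM_maxr.
Qed.

(** Rank-nullity for [pi] on the row space of [S]: [A] lies in the kernel, [C] in the image. *)
Lemma leq_rank_kermx (F : fieldType) m1 m2 m3 n q (S : 'M[F]_(m1, n))
    (A : 'M_(m2, n)) (C : 'M_(m3, q)) (pi : 'M_(n, q)) :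
  (A <= S)%MS -> A *m pi = 0 -> (C <= S *m pi)%MS ->
  (\rank A + \rank C <= \rank S)%N.
Proof.
move=> AS A0 CS; rewrite -(mxrank_mul_ker S pi) addnC leq_add ?mxrankS //.
by rewrite sub_capmx AS; apply/sub_kermxP.
Qed.

Lemma exists_subset_card (T : finType) (X : {set T}) k : (k <= #|X|)%N ->
  exists2 Y : {set T}, Y \subset X & #|Y| = k.
Proof.
move=> kX; exists [set x in take k (enum X)].
  by apply/subsetP => x; rewrite inE => /mem_take; rewrite mem_enum.
by rewrite cardsE; move/card_uniqP: (take_uniq k (enum_uniq X)) => ->;
  rewrite size_takel -?cardE.
Qed.

Section RowSpan.
Variables (R : realType) (V : finType) (d : nat).
Implicit Types (p : V -> 'rV[R]_d) (E : {set {set V}}) (P X : {set V}).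

Local Notation N := #|{: V * 'I_d}|.

Definition induced E P := [set e in E | e \subset P].

Definition nbrs E P v := [set x in P | [set v; x] \in E].

Definition edge_row p (e : {set V}) : 'rV[R]_N :=
  \row_j rigidity_row p e (col_vertex j) 0 (col_coord j).

(** Unlike that of [rigidity_mx], the type does not depend on [E], so the spaces of different edge
    sets can be compared. *)
Definition row_span p E : 'M[R]_N := (\sum_(e in E) <<edge_row p e>>)%MS.

Lemma rank_row_span p E : \rank (row_span p E) = \rank (rigidity_mx p E).
Proof.
apply: eqmx_rank; apply/andP; split.
  apply/sumsmx_subP => e eE; rewrite genmxE.
  have -> : edge_row p e = row (enum_rank_in eE e) (rigidity_mx p E).
    by apply/rowP => j; rewrite !mxE enum_rankK_in.
  exact: row_sub.
apply/row_subP => i; rewrite (_ : row i _ = edge_row p (enum_val i)).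
  by rewrite (sumsmx_sup (enum_val i)) ?enum_valP // genmxE.
by apply/rowP => j; rewrite !mxE.
Qed.

Definition vblock (v : V) : 'M[R]_(N, d) :=
  \matrix_(j, k) (enum_val j == (v, k))%:R.

Lemma mul_vblock (u : 'rV[R]_N) v :
  u *m vblock v = \row_k u 0 (enum_rank (v, k)).
Proof.
apply/rowP => k; rewrite !mxE (bigD1 (enum_rank (v, k))) //= mxE enum_rankK.
rewrite eqxx mulr1 big1 ?addr0 // => j jn; rewrite mxE.
case: eqP => [e|_]; last by rewrite mulr0.
by rewrite -e enum_valK eqxx in jn.
Qed.

Lemma vblock_inj (u w : 'rV[R]_N) :
  (forall v, u *m vblock v = w *m vblock v) -> u = w.
Proof.
move=> uw; apply/rowP => j; have := uw (enum_val j).1.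
move=> /rowP/(_ (enum_val j).2); rewrite !mul_vblock !mxE.
by rewrite -surjective_pairing enum_valK.
Qed.

(** The block [vblock c] picks out the columns of [c]. The case [a = b], where both sides vanish,
    lets sums run over all ordered pairs. *)
Lemma edge_row_vblock p a b c :
  edge_row p [set a; b] *m vblock c =
    (a == c)%:R *: (p c - p b) + (b == c)%:R *: (p c - p a).
Proof.
rewrite mul_vblock; apply/rowP => k; rewrite !mxE /rigidity_row.
rewrite /col_vertex /col_coord enum_rankK /= !inE.
have [->|ab] := eqVneq a b.
  rewrite setUid orbb (eq_sym c); case: eqP => [->|_].
    by rewrite big_set1 !subrr !mxE mulr0 addr0.
  by rewrite !mxE !mul0r addr0.
rewrite !(eq_sym c); have [<-|nac] := eqVneq a c => /=.
  rewrite big_setU1 ?inE //= big_set1 (subrr (p a)) add0r.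
  by rewrite (eq_sym b) (negPf ab) !mxE mul0r addr0 mul1r.
have [<-|nbc] := eqVneq b c => /=; last by rewrite !mxE !mul0r addr0.
rewrite big_setU1 ?inE //= big_set1 (subrr (p b)) addr0.
by rewrite !mxE mul0r add0r mul1r.
Qed.

Lemma edge_row_eq p p' (e : {set V}) :
  {in e, p =1 p'} -> edge_row p e = edge_row p' e.
Proof.
move=> pp'; apply/rowP => j; rewrite !mxE /rigidity_row.
case: ifP => // je; congr (fun_of_matrix _ _ _).
by apply: eq_bigr => x xe; rewrite !pp'.
Qed.

Lemma edge_row_notin p (e : {set V}) v : v \notin e -> edge_row p e *m vblock v = 0.
Proof.
move=> ve; rewrite mul_vblock; apply/rowP => k; rewrite !mxE /rigidity_row.
by rewrite /col_vertex enum_rankK (negPf ve) mxE.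
Qed.

Lemma edge_row_sub p E e : e \in E -> (edge_row p e <= row_span p E)%MS.
Proof. by move=> eE; rewrite (sumsmx_sup e) ?genmxE. Qed.

Lemma row_spanS p E E' : E \subset E' -> (row_span p E <= row_span p E')%MS.
Proof.
move=> EE'; apply/sumsmx_subP => e eE; rewrite genmxE edge_row_sub //.
exact: (subsetP EE').
Qed.

Lemma row_span_vblock p E v :
  (forall e, e \in E -> v \notin e) -> row_span p E *m vblock v = 0.
Proof.
move=> vE; apply/sub_kermxP/sumsmx_subP => e eE; rewrite genmxE.
by apply/sub_kermxP/edge_row_notin/vE.
Qed.


(** * Generic position *)

Section Generic.
Variable p : V -> 'rV[R]_d.
Hypothesis gp : generic p.

Definition evp (q : V -> 'rV[R]_d) : {rmorphism {mpoly rat[N]} -> R} :=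
  mmap (@ratr R) (coords q).

Definition Xvar (w : V) (k : 'I_d) : {mpoly rat[N]} := 'X_(enum_rank (w, k)).

Lemma evp_Xvar q w k : evp q (Xvar w k) = q w 0 k.
Proof.
by rewrite /evp /Xvar /= mmapX mmap1U /coords /col_vertex /col_coord enum_rankK.
Qed.

Lemma leq_rank_generic q m n (M : 'M[{mpoly rat[N]}]_(m, n)) :
  (\rank (map_mx (evp q) M) <= \rank (map_mx (evp p) M))%N.
Proof. by apply: leq_rank_map_mx_inj; apply: raddf_inj => f; exact: gp. Qed.

Lemma leq_rank_rigidity_mx q E :
  (\rank (row_span q E) <= \rank (row_span p E))%N.
Proof.
pose M : 'M[{mpoly rat[N]}]_(#|E|, N) := \matrix_(i, j)
  let e : {set V} := enum_val i in
  if col_vertex j \in e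
  then \sum_(x in e) (Xvar (col_vertex j) (col_coord j) - Xvar x (col_coord j))
  else 0.
have MP q0 : rigidity_mx q0 E = map_mx (evp q0) M.
  apply/matrixP => i j; rewrite !mxE /rigidity_row.
  case: ifP => _; last by rewrite mxE rmorph0.
  rewrite summxE rmorph_sum; apply: eq_bigr => x _.
  by rewrite !mxE rmorphB !evp_Xvar.
by rewrite !rank_row_span !MP leq_rank_generic.
Qed.

(** One realization of full rank suffices: [v] goes to the origin and the vertices of [X] to
    negatives of distinct unit vectors. *)
Lemma generic_affine_indep v X : v \notin X -> (#|X| <= d)%N ->
  row_free (\matrix_(i < #|X|) (p v - p (enum_val i))).
Proof.
move=> vX Xd; rewrite /row_free eqn_leq rank_leq_row /=.
pose M : 'M[{mpoly rat[N]}]_(#|X|, d) :=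
  \matrix_(i, k) (Xvar v k - Xvar (enum_val i) k).
have MP q : \matrix_(i < #|X|) (q v - q (enum_val i)) = map_mx (evp q) M.
  by apply/matrixP => i k; rewrite !mxE rmorphB !evp_Xvar.
pose q w : 'rV[R]_d := if w \in X then - \row_k (k == index w (enum X) :> nat)%:R else 0.
suff r : #|X| = \rank (pid_mx #|X| : 'M[R]_(#|X|, d)).
  rewrite MP {1}r; apply: leq_trans (leq_rank_generic q M).
  rewrite -MP (_ : \matrix_i _ = pid_mx #|X|) //.
  apply/matrixP => i k; rewrite !mxE /q (negPf vX) enum_valP !mxE add0r opprK.
  rewrite (enum_val_nth v) index_uniq ?enum_uniq // -?cardE //.
  by rewrite ltn_ord andbT eq_sym.
by rewrite rank_pid_mx.
Qed.

Definition diff_span (q : V -> 'rV[R]_d) v X : 'M[R]_d :=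
  (\sum_(x in X) <<q v - q x>>)%MS.

Lemma rank_diff_span v X : v \notin X ->
  (minn d #|X| <= \rank (diff_span p v X))%N.
Proof.
move=> vX; have [Y YX cY] : exists2 Y : {set V}, Y \subset X & #|Y| = minn d #|X|.
  exact/exists_subset_card/geq_minr.
have vY : v \notin Y by apply: contra vX; apply: subsetP.
have Yd : (#|Y| <= d)%N by rewrite cY geq_minl.
rewrite -cY -(eqP (generic_affine_indep vY Yd)); apply: mxrankS.
apply/row_subP => i; rewrite rowK (sumsmx_sup (enum_val i)) ?genmxE //.
exact: (subsetP YX _ (enum_valP i)).
Qed.

End Generic.

(** * Vertex extensions and stresses *)

Lemma nbrsP E P v x : reflect (x \in P /\ [set v; x] \in E) (x \in nbrs E P v).
Proof. by rewrite inE; apply: andP. Qed.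

Lemma star_vblock q E P v : v \notin P ->
  (diff_span q v (nbrs E P v) <= row_span q (induced E (v |: P)) *m vblock v)%MS.
Proof.
move=> vP; apply/sumsmx_subP => x /nbrsP[xP vxE]; rewrite genmxE.
have nxv : x == v = false by apply: contraNF vP => /eqP <-.
have -> : q v - q x = edge_row q [set v; x] *m vblock v.
  by rewrite edge_row_vblock eqxx nxv scale1r scale0r addr0.
apply/submxMr/edge_row_sub; rewrite inE vxE subUset !sub1set !inE eqxx xP.
by rewrite orbT.
Qed.

Lemma induced_vblock q E P v : v \notin P -> row_span q (induced E P) *m vblock v = 0.
Proof.
move=> vP; apply: row_span_vblock => e; rewrite inE => /andP[_ /subsetP eP].
by apply: contra vP => /eP.
Qed.

Lemma inducedS E P P' : P \subset P' -> induced E P \subset induced E P'.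
Proof.
move=> PP'; apply/subsetP => e; rewrite !inE => /andP[-> eP].
exact: subset_trans PP'.
Qed.

(** 0-extension: rows inside [P] vanish in the columns of [v], where the new edges span generic
    differences. *)
Lemma rank_add_vertex p E P v : generic p -> v \notin P ->
  (\rank (row_span p (induced E P)) + minn d #|nbrs E P v|
    <= \rank (row_span p (induced E (v |: P))))%N.
Proof.
move=> gp vP; apply: leq_trans (leq_rank_kermx (A := row_span p (induced E P)) _ _ (star_vblock p E vP)).
- rewrite leq_add2l rank_diff_span // inE; by rewrite (negPf vP).
- by apply/row_spanS/inducedS/subsetUr.
- exact: induced_vblock.
Qed.

Definition closed_in p E := forall e : {set V},
  #|e| = 2 -> (edge_row p e <= row_span p E)%MS -> e \in E.

(* 1-extension: placing v at the midpoint of x and y makes the stress on the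
   path x, v, y replace the edge xy. *)
Lemma rank_add_vertex_nonclique p E P v x y : generic p -> closed_in p E ->
  v \notin P -> x \in nbrs E P v -> y \in nbrs E P v -> x != y ->
  [set x; y] \notin E -> (d < #|nbrs E P v|)%N ->
  (\rank (row_span p (induced E P)) + d.+1
    <= \rank (row_span p (induced E (v |: P))))%N.
Proof.
move=> gp cE vP xN yN xy xyE dN.
pose q w := if w == v then 2^-1 *: (p x + p y) else p w.
have /nbrsP[xP vxE] := xN; have /nbrsP[yP vyE] := yN.
have nv z : z \in P -> (z == v) = false by move=> zP; apply: contraNF vP => /eqP <-.
have qP z : z \in P -> q z = p z by move=> zP; rewrite /q nv.
have qv : q v = 2^-1 *: (p x + p y) by rewrite /q eqxx.
(* Generic [p] maximizes the rank, so a bound in the special position [q] is enough. *)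
apply: leq_trans (leq_rank_rigidity_mx gp q _).
(* As [E] is closed and lacks the edge [xy], adding its row raises the rank. *)
pose A := (row_span q (induced E P) + edge_row q [set x; y])%MS.
have AE : (\rank (row_span p (induced E P)) < \rank A)%N.
  have qp : row_span q (induced E P) = row_span p (induced E P).
    apply: eq_bigr => e; rewrite inE => /andP[_ /subsetP eP].
    by rewrite (@edge_row_eq q p) // => w /eP /qP.
  have exy : edge_row q [set x; y] = edge_row p [set x; y].
    by apply: edge_row_eq => w; rewrite !inE => /orP[] /eqP ->; rewrite qP.
  have nsub : ~~ (edge_row p [set x; y] <= row_span p (induced E P))%MS.
    apply: contra xyE => h; apply: cE; first by rewrite cards2 xy.
    by apply: submx_trans h _; apply/row_spanS/subsetP => e; rewrite inE => /andP[].
  apply: rank_ltmx; rewrite /ltmx /A qp exy addsmxSl addsmx_sub submx_refl.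
  exact: nsub.
rewrite addnS -addSn; apply: leq_trans (leq_add AE (leqnn d)) _.
apply: leq_trans (leq_rank_kermx (A := A) _ _ (star_vblock q E vP)).
(* Differences based at [q v] span those from [x] to the other neighbours, which are generic and
   number at least [d]. *)
- rewrite leq_add2l; have xX : x \notin nbrs E P v :\ x by rewrite !inE eqxx.
  apply: leq_trans (mxrankS (_ : diff_span p x (nbrs E P v :\ x) <= _)%MS).
    apply: leq_trans (rank_diff_span gp xX).
    by rewrite leq_min leqnn -ltnS; move: dN; rewrite (cardsD1 x) xN.
  apply/sumsmx_subP => z; rewrite in_setD1 => /andP[zx zN]; rewrite genmxE.
  have zP : z \in P by case/nbrsP: zN.
  rewrite -(qP x) // -(qP z) // (_ : q x - q z = (q v - q z) - (q v - q x)).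
    rewrite addmx_sub ?eqmx_opp //; first by rewrite (sumsmx_sup z) ?genmxE.
    by rewrite (sumsmx_sup x) ?genmxE.
  by rewrite opprB [RHS]addrC addrA subrK.
- rewrite addsmx_sub row_spanS ?inducedS ?subsetUr //=.
  (* At the midpoint the two rows cancel in the columns of [v]. *)
  have -> : edge_row q [set x; y] = 2 *: (edge_row q [set v; x] + edge_row q [set v; y]).
    apply: vblock_inj => c; rewrite -scalemxAl mulmxDl !edge_row_vblock qv.
    apply/rowP => k; rewrite !mxE; have [<-|nc] := eqVneq v c.
      by rewrite qv (qP x) // (qP y) // !nv // !mxE; field.
    rewrite (qP x) // (qP y) //; have [<-|nx] := eqVneq x c.
      by rewrite (qP x) // (eq_sym y) (negPf xy) /=; field.
    by have [<-|ny] := eqVneq y c; rewrite ?(qP y) //=; field.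
  apply/scalemx_sub/addmx_sub; apply: edge_row_sub.
    by rewrite inE vxE subUset !sub1set !inE eqxx xP orbT.
  by rewrite inE vyE subUset !sub1set !inE eqxx yP orbT.
- apply/sub_kermxP; rewrite addsmx_sub; apply/andP; split; apply/sub_kermxP.
    exact: induced_vblock.
  by rewrite edge_row_notin // !inE !(eq_sym v) !nv.
Qed.

(* The affine dependency lam of d + 2 generic points yields the equilibrium
   stress lam a * lam b on their complete graph. *)
Lemma closed_in_glue p E (Z : {set V}) u w : generic p -> closed_in p E ->
  (forall a b, a \in Z -> b \in Z -> a != b -> [set a; b] \in E) ->
  (d <= #|Z|)%N -> u != w -> u \notin Z -> w \notin Z ->
  (forall a, a \in Z -> [set u; a] \in E) ->
  (forall a, a \in Z -> [set w; a] \in E) -> [set u; w] \in E.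
Proof.
move=> gp cE ZE /exists_subset_card[Y /subsetP YZ cY] uw uZ wZ uE wE.
have {}ZE a b : a \in Y -> b \in Y -> a != b -> [set a; b] \in E.
  by move=> /YZ aZ /YZ bZ; apply: ZE.
have {}uE a : a \in Y -> [set u; a] \in E by move=> /YZ /uE.
have {}wE a : a \in Y -> [set w; a] \in E by move=> /YZ /wE.
have {}uZ : u \notin Y by apply: contra uZ => /YZ.
have {}wZ : w \notin Y by apply: contra wZ => /YZ.
have Yd : (#|Y| <= d)%N by rewrite cY.
(* The [d] generic differences based at [u] form a basis. *)
have [c cP] : exists c : V -> R, p u - p w = \sum_(a in Y) c a *: (p u - p a).
  have fr := generic_affine_indep gp uZ Yd.
  have /submxP[D ->] : (p u - p w <= \matrix_(i < #|Y|) (p u - p (enum_val i)))%MS.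
    by rewrite submx_full // /row_full (eqP fr) cY.
  exists (fun a => \sum_(i < #|Y| | enum_val i == a) D 0 i).
  rewrite mulmx_sum_row [RHS]big_enum_val; apply: eq_bigr => i _; rewrite rowK.
  by rewrite (big_pred1 i) // => j; rewrite (inj_eq enum_val_inj).
(* The relation [cP], rewritten as an affine dependency: the coefficients sum to zero and [w] has
   coefficient -1. *)
pose lam x : R := if x == w then -1 else if x == u then 1 - \sum_(a in Y) c a
  else if x \in Y then c x else 0.
have lamE (U : lmodType R) (F : V -> U) : \sum_x lam x *: F x =
    - F w + ((1 - \sum_(a in Y) c a) *: F u + \sum_(a in Y) c a *: F a).
  rewrite (bigD1 w) //= (bigD1 u) //= /lam !eqxx (negPf uw) scaleN1r.
  congr (_ + (_ + _)); rewrite big_mkcond [RHS]big_mkcond; apply: eq_bigr => x _ /=.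
  have [->|_] := eqVneq x w; first by rewrite (negPf wZ).
  have [->|_] := eqVneq x u; first by rewrite (negPf uZ).
  by case: ifP => //; rewrite scale0r.
have lam0 z : \sum_x lam x *: (p z - p x) = 0.
  have lamD : \sum_x lam x *: (p u - p x) = 0.
    by rewrite lamE -cP subrr scaler0 add0r addNr.
  have lam1 : \sum_x lam x = 0.
    transitivity (\sum_x lam x *: (1 : R^o)).
      by apply: eq_bigr => x _; rewrite [RHS]mulr1.
    by rewrite lamE -scaler_suml -scalerDl subrK scale1r addNr.
  rewrite -[RHS]lamD; apply/eqP; rewrite -subr_eq0 -sumrB; apply/eqP.
  under eq_bigr do rewrite -scalerBr opprB addrA subrK.
  by rewrite -scaler_suml lam1 scale0r.
(* Otherwise [w] would be an affine combination of [Y] alone, against generic independence. *)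
have lamu : lam u != 0.
  rewrite /lam (negPf uw) eqxx; apply/negP; rewrite subr_eq0 => /eqP c1.
  have fr := generic_affine_indep gp wZ Yd.
  have /eqP : (\row_(i < #|Y|) c (enum_val i)) *m
      (\matrix_(i < #|Y|) (p w - p (enum_val i))) = 0.
    rewrite mulmx_sum_row; under eq_bigr do rewrite rowK mxE.
    rewrite -(big_enum_val (fun a => c a *: (p w - p a))).
    transitivity (\sum_(a in Y) c a *: (p u - p a) - (p u - p w));
      last by rewrite cP subrr.
    rewrite -[X in _ - X]scale1r {1}c1 scaler_suml -sumrB; apply: eq_bigr => a _.
    by rewrite -scalerBr opprB [in RHS]addrC addrA subrK.
  rewrite (mulmx_free_eq0 _ fr) => /eqP/rowP c0.
  suff : \sum_(a in Y) c a = 0 by rewrite -c1 => /eqP; rewrite oner_eq0.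
  by rewrite big_enum_val big1 // => i _; have := c0 i; rewrite !mxE.
(* In the columns of [z], each half of the double sum reduces to multiples of the zero sum in
   [lam0]. *)
have stress : \sum_a \sum_b (lam a * lam b) *: edge_row p [set a; b] = 0.
  apply: vblock_inj => z; rewrite mul0mx mulmx_suml.
  under eq_bigr do rewrite mulmx_suml.
  under eq_bigr do under eq_bigr do
    rewrite -scalemxAl edge_row_vblock scalerDr !scalerA.
  under eq_bigr do rewrite big_split /=; rewrite big_split /=.
  rewrite [X in _ + X]exchange_big /= !big1 ?addr0 // => a _.
    under eq_bigr do rewrite [lam _ * lam a]mulrC mulrAC -scalerA.
    by rewrite -scaler_sumr lam0 scaler0.
  under eq_bigr do rewrite mulrAC -scalerA.
  by rewrite -scaler_sumr lam0 scaler0.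
apply: cE; first by rewrite cards2 uw.
(* The cokernel kills the rows of [E]; of the stress only the two ordered pairs of [u] and [w]
   survive, with coefficient [2 * lam u * lam w]. *)
rewrite submxE; set C := cokermx _.
have inC e : e \in E -> edge_row p e *m C = 0.
  by move=> eE; apply/eqP; rewrite -submxE edge_row_sub.
have diag a : edge_row p [set a; a] = 0.
  by apply: vblock_inj => z; rewrite mul0mx edge_row_vblock; case: eqP => [->|_];
    rewrite ?subrr ?scaler0 ?scale0r addr0.
have supp x : lam x != 0 -> [|| x == w, x == u | x \in Y].
  by rewrite /lam; case: (x == w); case: (x == u); case: (x \in Y); rewrite ?eqxx.
have term a b : (a, b) != (u, w) -> (a, b) != (w, u) ->
    (lam a * lam b) *: (edge_row p [set a; b] *m C) = 0.
  rewrite !xpair_eqE; have [->|ab] := eqVneq a b; first by rewrite diag mul0mx scaler0.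
  have [->|/supp] := eqVneq (lam a) 0; first by rewrite mul0r scale0r.
  have [->|/supp] := eqVneq (lam b) 0; first by rewrite mulr0 scale0r.
  move=> /or3P[/eqP bE|/eqP bE|bY] /or3P[/eqP aE|/eqP aE|aY]; move: ab;
    rewrite ?aE ?bE ?eqxx // => ab _ _; rewrite inC ?scaler0 //.
  - by rewrite setUC wE.
  - by rewrite setUC uE.
  - exact: wE.
  - exact: uE.
  - exact: ZE.
move/(congr1 (mulmx^~ C)): stress; rewrite mul0mx mulmx_suml.
under eq_bigr do rewrite mulmx_suml.
under eq_bigr do under eq_bigr do rewrite -scalemxAl.
rewrite pair_big /= (bigD1 (u, w)) //= (bigD1 (w, u)) /=; last first.
  by rewrite xpair_eqE negb_and (eq_sym w) uw.
rewrite big1 => [|[a b] /andP[]]; last by move=> *; apply: term.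
rewrite addr0 (setUC [set w]) (mulrC (lam w)) -scalerDl => /eqP.
rewrite scaler_eq0 => /orP[|//]; rewrite -mulr2n mulrn_eq0 /= mulf_eq0 (negPf lamu).
by rewrite /lam eqxx oppr_eq0 oner_eq0.
Qed.

End RowSpan.

(** * Gains in a random vertex order *)

(* Averaging over the vertex removed last replaces the random vertex order. *)
Lemma sum_le_vertex_removal (V : finType) (f : {set V} -> rat)
    (g b : V -> {set V} -> rat) :
  0 <= f set0 ->
  (forall (W : {set V}) v, v \in W -> f (W :\ v) + g v W <= f W) ->
  (forall (W : {set V}) v, v \in W ->
    #|W|%:R * b v W <= g v W + \sum_(u in W :\ v) b v (W :\ u)) ->
  forall W : {set V}, \sum_(v in W) b v W <= f W.
Proof.
move=> f0 fg gb W; elim: {W}_.+1 {-2}W (ltnSn #|W|) => // n IHn W Wn.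
have [->|[w wW]] := set_0Vmem W; first by rewrite big_set0.
have W0 : 0 < #|W|%:R :> rat by rewrite ltr0n card_gt0; apply/set0Pn; exists w.
rewrite -(ler_pM2l W0).
have -> : #|W|%:R * f W = \sum_(v in W) f W by rewrite sumr_const mulr_natl.
apply: (@le_trans _ _ (\sum_(v in W) (\sum_(u in W :\ v) b u (W :\ v) + g v W))).
  rewrite big_split /= (exchange_big_dep (mem W)) /=; last first.
    by move=> v u vW; rewrite in_setD1 => /andP[].
  rewrite mulr_sumr -big_split; apply: ler_sum => v vW /=.
  apply: le_trans (gb _ _ vW) _; rewrite addrC. rewrite lerD2l.
  rewrite le_eqVlt; apply/predU1P; left; apply: eq_bigl => u.
  by rewrite !in_setD1 vW andbT eq_sym andbC.
apply: ler_sum => v vW; apply: le_trans (fg _ _ vW); rewrite lerD2r IHn //.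
by move: Wn; rewrite (cardsD1 v) vW.
Qed.

(** * Expected gain of one vertex *)

Section VertexBound.
Variable d : nat.

Definition triang : rat := (d * d.+1)%:R / 2.

(* The expected gain in rank of a vertex with k neighbours, taken in a uniformly
   random vertex order: exact when the neighbours form a clique or k <= d, a
   lower bound otherwise. *)
Definition vertex_bound (k : nat) (clique : bool) : rat :=
  if (k <= d)%N then k%:R / 2
  else if clique then d%:R - triang / k.+1%:R else d%:R + 2^-1 - triang / k%:R.

(** The mean of [minn d j] over [j = 0, ..., k]. The formula still holds at [k = d], which lets the
    recurrences cross between the two regimes. *)
Lemma vertex_bound_clique k : (d <= k)%N ->
  vertex_bound k true = d%:R - triang / k.+1%:R.
Proof.
rewrite /vertex_bound /triang leq_eqVlt => /predU1P[<-|/ltn_geF ->//].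
by rewrite leqnn natrM; field; rewrite nat1r pnatr_eq0.
Qed.

Lemma vertex_bound_nonclique k : (0 < d <= k)%N ->
  vertex_bound k false = d%:R + 2^-1 - triang / k%:R.
Proof.
rewrite /vertex_bound /triang => /andP[d0]; rewrite leq_eqVlt.
case/predU1P => [<-|/ltn_geF ->//].
by rewrite leqnn natrM -addn1 natrD; field; rewrite pnatr_eq0 -lt0n.
Qed.

Lemma vertex_bound_small k c : (k <= d)%N -> vertex_bound k c = k%:R / 2.
Proof. by rewrite /vertex_bound => ->. Qed.

Lemma vertex_bound_mono k c : (0 < d)%N -> vertex_bound k true <= vertex_bound k c.
Proof.
move=> d0; case: c => //; have [kd|dk] := leqP k d.
  by rewrite !vertex_bound_small.
rewrite vertex_bound_clique ?vertex_bound_nonclique ?d0 1?ltnW //.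
have k0 : k%:R != 0 :> rat by rewrite pnatr_eq0 -lt0n (ltn_trans d0).
have k1 : k.+1%:R != 0 :> rat by rewrite pnatr_eq0.
have kk : 0 < k%:R * k.+1%:R :> rat by rewrite -natrM ltr0n muln_gt0 (ltn_trans d0).
rewrite -(ler_pM2r kk) -subr_ge0.
have -> : (d%:R + 2^-1 - triang / k%:R) * (k%:R * k.+1%:R) -
    (d%:R - triang / k.+1%:R) * (k%:R * k.+1%:R) =
    (k * k.+1 - d * d.+1)%:R / 2 :> rat.
  rewrite natrB ?natrM /triang; last by rewrite leq_mul // ltnW.
  by rewrite natrM; field; rewrite k0 nat1r k1.
by rewrite divr_ge0 ?ler0n.
Qed.

Lemma le_vertex_bound k c : (0 < d)%N ->
  d%:R - triang / k.+1%:R <= vertex_bound k c.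
Proof.
move=> d0; apply: le_trans (vertex_bound_mono k c d0).
have [dk|/ltnW kd] := leqP d k; first by rewrite vertex_bound_clique.
rewrite vertex_bound_small // lerBlDr -lerBlDl ler_pdivlMr ?ltr0n // /triang.
rewrite -(subnKC kd) natrM -[(_ + _).+1%:R]natr1 -[k.+1%:R]natr1 natrD.
(* With [e = d - k] the gap is [e * (e - 1)] up to a positive factor, and [e] is a natural
   number. *)
have : 0 <= (d - k)%:R * ((d - k)%:R - 1) :> rat.
  by case: (d - k)%N => [|e]; rewrite ?mul0r // mulr_ge0 ?ler0n // -natr1 addrK ler0n.
by move: (d - k)%:R k%:R => e x; nra.
Qed.

(** Recurrence on which of the [k + 2] vertices, [v] or one of its [k + 1] neighbours, comes
    last. *)
Lemma vertex_bound_step_clique k :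
  k.+2%:R * vertex_bound k.+1 true <=
    (minn d k.+1)%:R + k.+1%:R * vertex_bound k true.
Proof.
have [kd|dk] := leqP k.+1 d.
  rewrite !(vertex_bound_small _ kd, vertex_bound_small _ (ltnW kd)) -[k.+2%:R]natr1 -[k.+1%:R]natr1.
  by move: k%:R => x; nra.
rewrite (vertex_bound_clique (ltnW dk)) (vertex_bound_clique dk) !mulrBr.
rewrite ![_ * (triang / _)]mulrC !divfK ?pnatr_eq0 // -[k.+2%:R]natr1; lra.
Qed.

(** The same recurrence when one neighbour is allowed to leave a clique behind and the other [k] do
    not. *)
Lemma vertex_bound_step_nonclique k : (0 < d < k.+1)%N ->
  k.+2%:R * vertex_bound k.+1 false <=
    d.+1%:R + vertex_bound k true + k%:R * vertex_bound k false.
Proof.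
case/andP=> d0; rewrite ltnS => dk.
have k0 : k%:R != 0 :> rat by rewrite pnatr_eq0 -lt0n (leq_trans d0).
have k1 : k.+1%:R != 0 :> rat by rewrite pnatr_eq0.
rewrite vertex_bound_clique // !vertex_bound_nonclique ?d0 // 1?ltnW //.
rewrite le_eqVlt; apply/predU1P; left; rewrite -[k.+2%:R]natr1 -[k.+1%:R]natr1 -[d.+1%:R]natr1; field.
by rewrite k0 natr1 k1.
Qed.

End VertexBound.

(** * Cliques and neighbourhoods *)

Definition clique (V : finType) (E : {set {set V}}) (N : {set V}) : bool :=
  [forall a in N, forall b in N, (a != b) ==> ([set a; b] \in E)].

Lemma cliqueP (V : finType) (E : {set {set V}}) (N : {set V}) :
  reflect (forall a b, a \in N -> b \in N -> a != b -> [set a; b] \in E) (clique E N).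
Proof.
apply: (iffP forall_inP) => [h a b aN bN ab|h a aN].
  by have /forall_inP/(_ _ bN)/implyP := h _ aN; apply.
by apply/forall_inP => b bN; apply/implyP => ab; apply: h.
Qed.

Lemma clique_sub (V : finType) (E : {set {set V}}) (N N' : {set V}) :
  N' \subset N -> clique E N -> clique E N'.
Proof.
by move=> /subsetP s /cliqueP h; apply/cliqueP => a b /s aN /s bN; apply: h.
Qed.

Section SimpleNbrs.
Variables (V : finType) (E : {set {set V}}).
Hypothesis sE : simple_graph E.
Implicit Types (P W : {set V}) (u v : V).

Lemma simple_loop v : ([set v; v] \in E) = false.
Proof. by apply/negP => /sE; rewrite setUid cards1. Qed.

Lemma nbrs_self W v : v \notin nbrs E W v.
Proof. by rewrite inE simple_loop andbF. Qed.

Lemma nbrs_setD1 W u v : nbrs E (W :\ u) v = nbrs E W v :\ u.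
Proof. by apply/setP => x; rewrite !inE andbA. Qed.

Lemma nbrs_setD1_self W v : nbrs E (W :\ v) v = nbrs E W v.
Proof.
rewrite nbrs_setD1; apply/setP => x; rewrite in_setD1; case: eqP => // ->.
by rewrite (negPf (nbrs_self _ _)).
Qed.

Lemma sum_card_nbrs W : (\sum_(v in W) #|nbrs E W v| <= 2 * #|induced E W|)%N.
Proof.
have -> : (2 * #|induced E W| = \sum_(e in induced E W) \sum_(v in e) 1)%N.
  rewrite mulnC -sum_nat_const; apply: eq_bigr => e; rewrite inE => /andP[eE _].
  by rewrite sum1_card sE.
rewrite (exchange_big_dep (mem W)) /=; last first.
  by move=> e v; rewrite inE => /andP[_ /subsetP eW] /eW.
apply: leq_sum => v vW; rewrite sum1dep_card.
have inj : {in nbrs E W v &, injective (fun x => [set v; x])}.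
  move=> x y xN yN /setP/(_ x); rewrite !inE eqxx orbT => /esym/orP[] /eqP // xv.
  by move: xN; rewrite xv (negPf (nbrs_self _ _)).
rewrite -(card_in_imset inj); apply/subset_leq_card/subsetP => e /imsetP[x].
by case/nbrsP => xW vxE ->; rewrite !inE vxE subUset !sub1set vW xW !eqxx.
Qed.

End SimpleNbrs.

(** * Rank bound for a closed graph *)

Section RankBound.
Variables (R : realType) (V : finType) (d : nat) (p : V -> 'rV[R]_d).
Variable E : {set {set V}}.
Hypotheses (d0 : (0 < d)%N) (gp : generic p) (sE : simple_graph E).
Hypothesis cE : closed_in p E.

(** Both [u] and [u'] are joined to the clique formed by [v] and the rest of [N], which has at least
    [d] vertices, so [closed_in_glue] joins them. *)
Lemma clique_merge v (N : {set V}) u u' : (forall x, x \in N -> [set v; x] \in E) ->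
  (d < #|N|)%N -> u \in N -> u' \in N -> u != u' ->
  clique E (N :\ u) -> clique E (N :\ u') -> clique E N.
Proof.
move=> vN dN uN u'N uu' /cliqueP cu /cliqueP cu'.
have vnN : v \notin N by apply/negP => /vN; rewrite simple_loop.
have nv x : x \in N -> x != v by apply: contraTneq => ->.
have uu'E : [set u; u'] \in E.
  apply: (closed_in_glue (Z := v |: (N :\ u :\ u')) gp cE) => //.
  - move=> a b /setU1P[->|aN] /setU1P[->|bN]; rewrite ?eqxx // => ab.
    + by apply: vN; move: bN; rewrite !inE => /and3P[].
    + by rewrite setUC; apply: vN; move: aN; rewrite !inE => /and3P[].
    + by apply: cu => //; [move: aN|move: bN]; rewrite in_setD1 => /andP[].
  - move: dN; rewrite cardsU1 !inE (negPf vnN) !andbF /= (cardsD1 u) uN.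
    by rewrite (cardsD1 u') !inE eq_sym uu' u'N.
  - by rewrite !inE eqxx andbF orbF nv.
  - by rewrite !inE eqxx orbF nv.
  - move=> a /setU1P[->|]; first by rewrite setUC vN.
    by rewrite !inE => /and3P[au' au aN]; apply: cu'; rewrite ?inE ?uu' ?au' // eq_sym.
  - move=> a /setU1P[->|]; first by rewrite setUC vN.
    have u'u : u' != u by rewrite eq_sym.
    rewrite !inE => /and3P[au' au aN]; apply: cu; rewrite ?inE ?u'u ?au //.
    by rewrite eq_sym.
apply/cliqueP => a b aN bN ab.
have [au|au] := eqVneq a u.
  have [bu'|bu'] := eqVneq b u'; first by rewrite au bu'.
  by apply: cu'; rewrite ?inE ?bu' // au uu'.
have [bu|bu] := eqVneq b u; last by apply: cu; rewrite ?inE ?au ?bu.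
have [au'|au'] := eqVneq a u'; first by rewrite au' bu setUC.
by apply: cu'; rewrite ?inE ?au' // bu uu'.
Qed.

Let gain (N : {set V}) := (minn d #|N| + ((d < #|N|) && ~~ clique E N))%N.
Let bound (N : {set V}) := vertex_bound d #|N| (clique E N).

Lemma rank_gain (W : {set V}) v : v \in W ->
  (\rank (row_span p (induced E (W :\ v))) + gain (nbrs E W v)
    <= \rank (row_span p (induced E W)))%N.
Proof.
move=> vW; rewrite -(nbrs_setD1_self sE) -{3}(setD1K vW) /gain.
have vP : v \notin W :\ v by rewrite !inE eqxx.
move: (W :\ v) vP => P vP; case: andP => [[dk]|_]; last first.
  by rewrite addn0 rank_add_vertex.
move=> /forall_inPn[x xN /forall_inPn[y yN]]; rewrite negb_imply => /andP[xy xyE].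
rewrite (minn_idPl (ltnW dk)) addn1.
exact: (rank_add_vertex_nonclique gp cE vP xN yN xy xyE dk).
Qed.

Lemma bound_step v (N : {set V}) : (forall x, x \in N -> [set v; x] \in E) ->
  #|N|.+1%:R * bound N <= (gain N)%:R + \sum_(u in N) bound (N :\ u).
Proof.
move=> vN; have cN u : u \in N -> #|N| = #|N :\ u|.+1 by rewrite (cardsD1 u N) => ->.
rewrite /gain /bound; have [N0|[u0 u0N]] := set_0Vmem N.
  by rewrite N0 big_set0 addr0 cards0 vertex_bound_small // mul0r mulr0 ler0n.
case Nk : #|N| => [|k]; first by rewrite (cN _ u0N) in Nk.
have {}cN u : u \in N -> #|N :\ u| = k by move=> uN; move: Nk; rewrite (cN u uN) => -[].
under eq_bigr => u uN do rewrite (cN u uN).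
have small c : (k.+1 <= d)%N -> vertex_bound d k.+1 c = vertex_bound d k.+1 true.
  by move=> kd; rewrite !vertex_bound_small.
rewrite ltnS; have [dk|kd] := leqP d k; last first.
  rewrite andFb addn0 small //; apply: le_trans (vertex_bound_step_clique _ _) _.
  rewrite lerD2l -Nk mulr_natl -sumr_const; apply: ler_sum => u uN.
  by rewrite !vertex_bound_small 1?ltnW.
case: (boolP (clique E N)) => cl /=.
  rewrite addn0; apply: le_trans (vertex_bound_step_clique _ _) _.
  rewrite lerD2l -Nk mulr_natl -sumr_const; apply: ler_sum => u uN.
  by rewrite (clique_sub (subD1set _ _) cl).
rewrite addn1 (minn_idPl (leqW dk)).
apply: le_trans (vertex_bound_step_nonclique _) _; first by rewrite d0 ltnS dk.
rewrite -addrA lerD2l.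
(* Only the removal of [u1] can leave a clique. If no removal does, any [u0] serves, as the clique
   value is the smaller one. *)
have [u1 u1N uniq] : exists2 u1, u1 \in N &
    forall u, u \in N -> u != u1 -> ~~ clique E (N :\ u).
  case: (pickP [pred u in N | clique E (N :\ u)]) => [u1 /andP[u1N c1]|none].
    exists u1 => // u uN uu1; apply: contra cl => cu.
    by apply: (clique_merge vN _ uN u1N uu1 cu c1); rewrite Nk.
  by exists u0 => // u uN _; have := none u; rewrite /= uN => /= ->.
rewrite (bigD1 u1) //= lerD ?vertex_bound_mono //.
have -> : k%:R * vertex_bound d k false = \sum_(u in N :\ u1) vertex_bound d k false.
  by rewrite sumr_const cN // mulr_natl.
rewrite le_eqVlt; apply/predU1P; left; apply: eq_big => u.
  by rewrite !inE andbC.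
by rewrite !inE => /andP[uu1 uN]; rewrite (negPf (uniq _ uN uu1)).
Qed.

Lemma rank_induced_ge (W : {set V}) :
  \sum_(v in W) vertex_bound d #|nbrs E W v| (clique E (nbrs E W v)) <=
    (\rank (row_span p (induced E W)))%:R.
Proof.
apply: (@sum_le_vertex_removal _ (fun W => (\rank (row_span p (induced E W)))%:R)
  (fun v W => (gain (nbrs E W v))%:R) (fun v W => bound (nbrs E W v))) => {W}.
- exact: ler0n.
- by move=> W v vW; rewrite -natrD ler_nat rank_gain.
move=> W v vW; set N := nbrs E W v.
have NW : N \subset W :\ v.
  apply/subsetP => x xN; rewrite in_setD1; case/nbrsP: (xN) => -> _.
  by rewrite andbT; apply: contraTneq xN => ->; apply: nbrs_self.
have step := @bound_step v N (fun x xN => (elimT (nbrsP _ _ _ _) xN).2).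
(* Removing a vertex outside [N] changes nothing at [v], so these terms cancel and only [v] and [N]
   remain. *)
rewrite (big_setID N) /= (setIidPr NW).
under eq_bigr => u _ do rewrite nbrs_setD1.
rewrite [X in _ + (_ + X)](eq_bigr (fun=> bound N)); last first.
  move=> u; rewrite inE nbrs_setD1 => /andP[uN _].
  by congr bound; apply/setDidPl; rewrite disjoint_sym disjoints1.
rewrite sumr_const cardsD (setIidPr NW) addrA -[bound N *+ _]mulr_natl.
have := subset_leq_card NW; have -> : #|W| = #|W :\ v|.+1 by rewrite (cardsD1 v) vW.
move=> le; rewrite natrB // mulrBl -natr1 -lerBlDr.
move: step; rewrite -[#|N|.+1%:R]natr1 /N; lra.
Qed.

End RankBound.

(** * Closures and connectivity *)

Section Closure.
Variables (R : realType) (V : finType) (d : nat) (p : V -> 'rV[R]_d).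
Variable E : {set {set V}}.
Hypothesis sE : simple_graph E.

(** Singletons have zero rows; the size condition keeps the closure a simple graph. *)
Definition row_closure : {set {set V}} :=
  [set e : {set V} | (#|e| == 2) && (edge_row p e <= row_span p E)%MS].

Lemma sub_row_closure : E \subset row_closure.
Proof. by apply/subsetP => e eE; rewrite inE sE // eqxx edge_row_sub. Qed.

Lemma row_span_closure : (row_span p row_closure <= row_span p E)%MS.
Proof.
by apply/sumsmx_subP => e; rewrite inE => /andP[_ eS]; rewrite genmxE.
Qed.

Lemma simple_row_closure : simple_graph row_closure.
Proof. by move=> e; rewrite inE => /andP[/eqP]. Qed.

Lemma closed_in_row_closure : closed_in p row_closure.
Proof.
move=> e e2 eS; rewrite inE e2 eqxx.
exact: submx_trans eS row_span_closure.
Qed.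

End Closure.

Section Connectivity.
Variables (V : finType) (G : {set {set V}}).
Hypothesis sG : simple_graph G.
Implicit Types (S T W : {set V}).

(** A walk visits [v] between two neighbours of [v] that are equal or adjacent, so it can bypass
    [v]. *)
Lemma connected_minus_simplicial T v : v \notin T ->
  (forall x y, x \notin T -> y \notin T -> [set v; x] \in G ->
    [set v; y] \in G -> x != y -> [set x; y] \in G) ->
  connected_minus G T -> connected_minus G (v |: T).
Proof.
move=> vT simplicial GT u w; rewrite !in_setU1 !negb_or => /andP[uv uT] /andP[wv wT].
have /connectP[q] := GT u w uT wT.
(* Induction on the length, because a bypass consumes two vertices of the walk at once. *)
elim: {q}(size q).+1 {-2}q (ltnSn (size q)) u uv uT => // n IHn.
case=> [|x q] /= qn u uv uT; first by move=> _ ->.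
case/andP=> /and3P[_ xT uxG] xq wE.
have [xv|xv] := eqVneq x v; last first.
  apply: connect_trans (IHn q qn x xv xT xq wE); apply: connect1.
  by rewrite /adj_avoiding /= !in_setU1 !negb_or uv uT xv xT.
case: q qn xq wE => [|y q] qn /=; first by move=> _ wx; rewrite wx xv eqxx in wv.
case/andP=> /and3P[_ yT xyG] yq wE.
have yv : y != v by apply: contraTneq xyG => ->; rewrite xv simple_loop.
have := IHn q (ltn_trans (ltnSn _) qn) y yv yT yq wE.
have [->//|uy] := eqVneq u y; apply: connect_trans; apply: connect1.
rewrite /adj_avoiding /= !in_setU1 !negb_or uv uT yv yT; apply: simplicial => //.
  by rewrite setUC -xv.
by rewrite -xv.
Qed.

(** Connectivity of the subgraph induced on [W] without changing the vertex type: the complement of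
    [W] is deleted too, at no cost. *)
Definition k_connected_in k W := (k < #|W|)%N /\
  forall S, (#|S :&: W| < k)%N -> connected_minus G (S :|: ~: W).

(** Fewer than [k] neighbours would separate [v] from another vertex of [W]. *)
Lemma k_connected_in_nbrs k W v : k_connected_in k W -> v \in W ->
  (k <= #|nbrs G W v|)%N.
Proof.
move=> [kW conn] vW; rewrite leqNgt; apply/negP => lt_k.
have NW : nbrs G W v \subset W by apply/subsetP => x /nbrsP[].
have [w wW] : exists w, w \in W :\: (v |: nbrs G W v).
  apply/set0Pn; rewrite -card_gt0 cardsD subn_gt0.
  apply: leq_ltn_trans (subset_leq_card (subsetIr _ _)) _.
  by rewrite cardsU1 (nbrs_self sG) add1n; apply: leq_ltn_trans kW.
move: wW; rewrite in_setD in_setU1 negb_or => /andP[/andP[wv wN] wW].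
have := conn (nbrs G W v); rewrite (setIidPl NW) => /(_ lt_k v w).
rewrite !in_setU !in_setC vW wW (negPf (nbrs_self sG _ _)) (negPf wN) => /(_ isT isT).
case/connectP => -[|x q] /=; first by move=> _ wE; rewrite wE eqxx in wv.
case/andP=> /and3P[_]; rewrite in_setU in_setC negb_or negbK => /andP[xN xW] vx.
by case/negP: xN; apply/nbrsP.
Qed.

Lemma k_connected_in_setD1 k W v : k_connected_in k W -> v \in W -> (k < #|W :\ v|)%N ->
  clique G (nbrs G W v) -> k_connected_in k (W :\ v).
Proof.
move=> [_ conn] vW kW /cliqueP cl; split=> // S Sk.
have -> : S :|: ~: (W :\ v) = v |: (S :\ v :|: ~: W).
  by apply/setP => x; rewrite !inE; case: eqP => //=; rewrite orbT.
apply: connected_minus_simplicial.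
- by rewrite !inE eqxx vW.
- move=> x y; rewrite !in_setU !in_setC !negb_or !negbK => /andP[_ xW] /andP[_ yW].
  by move=> vx vy; apply: cl; apply/nbrsP.
apply: conn; apply: leq_ltn_trans Sk; apply/subset_leq_card/subsetP => x.
by rewrite !inE => /andP[/andP[-> ->] ->].
Qed.

End Connectivity.

(** * Summing over the dimensions *)

Lemma sum_triang s (d : 'I_s -> nat) :
  \sum_i triang (d i) = (\sum_i d i * (d i).+1)%N%:R / 2.
Proof. by rewrite -mulr_suml -natr_sum. Qed.

(** Here the value of [K] enters: the numbers [triang (d i)] total [K / 2]. If [f > 0], the loss is
    at most [f / 2] since [K <= f * (K - f + 1)], also with truncated subtraction. If [f = 0], the
    extra [1 / 2] of one nonclique offsets the loss. *)
Lemma sum_vertex_bound_ge s (d k : 'I_s -> nat) (c : 'I_s -> bool) (f : nat) :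
  (forall i, (0 < d i)%N) ->
  (forall i, (\sum_(i < s) d i * (d i).+1 - f <= k i)%N) ->
  (f = 0 -> exists i, ~~ c i) ->
  \sum_i (d i)%:R <= \sum_i vertex_bound (d i) (k i) (c i) + f%:R / 2 :> rat.
Proof.
move=> d0; have := sum_triang d; set K := (\sum_(i < s) _)%N => tK kK fc.
have [f0|f0] := posnP f.
  have [i0 c0] := fc f0; rewrite f0 mul0r addr0.
  have Kd i : (d i * (d i).+1 <= K)%N by rewrite /K (bigD1 i) //= leq_addr.
  have K0 : (0 < K)%N by apply: leq_trans (Kd i0); rewrite muln_gt0 d0.
  have {}kK i : (K <= k i)%N by rewrite -(subn0 K) -f0.
  have tri0 i : 0 <= triang (d i) by rewrite divr_ge0 ?ler0n.
  (* The denominator is weakened to [K] to match the nonclique formula; the losses then total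
     exactly [1 / 2]. *)
  have le i : (d i)%:R - triang (d i) / K%:R <= vertex_bound (d i) (k i) (c i).
    apply: le_trans (le_vertex_bound _ _ (d0 i)); rewrite lerD2l lerN2.
    by rewrite ler_wpM2l // lef_pV2 ?posrE ?ltr0n // ler_nat leqW.
  have le0 : (d i0)%:R - triang (d i0) / K%:R + 2^-1 <=
      vertex_bound (d i0) (k i0) (c i0).
    rewrite (negPf c0) vertex_bound_nonclique; last first.
      by rewrite d0 (leq_trans _ (leq_trans (Kd i0) (kK i0))) // leq_pmulr.
    rewrite addrAC lerD2l lerN2.
    by rewrite ler_wpM2l // lef_pV2 ?posrE ?ltr0n ?(leq_trans K0) // ler_nat.
  have tot : \sum_i ((d i)%:R - triang (d i) / K%:R) + 2^-1 = \sum_i (d i)%:R.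
    rewrite sumrB -mulr_suml tK; field; by rewrite pnatr_eq0 -lt0n.
  rewrite -tot (bigD1 i0) //= [leRHS](bigD1 i0) //= addrAC.
  by apply: lerD => //; apply: ler_sum.
apply: (@le_trans _ _ (\sum_i ((d i)%:R - triang (d i) / (K - f).+1%:R) + f%:R / 2)).
  rewrite sumrB -mulr_suml tK -addrA lerDl addrC subr_ge0 mulrAC.
  rewrite ler_wpM2r ?invr_ge0 ?ler0n // ler_pdivrMr ?ltr0n // -natrM ler_nat; nia.
rewrite lerD2r; apply: ler_sum => i _; apply: le_trans (le_vertex_bound _ _ (d0 i)).
rewrite lerD2l lerN2 ler_wpM2l ?divr_ge0 ?ler0n //.
by rewrite lef_pV2 ?posrE ?ltr0n // ler_nat ltnS.
Qed.

(** * Induction on the vertex set *)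

Section Main.
Variables (R : realType) (V : finType) (s : nat) (d : 'I_s -> nat).
Variable p : forall i, V -> 'rV[R]_(d i).
Variables (H : 'I_s -> {set {set V}}) (F : {set {set V}}).
Hypotheses (s0 : (0 < s)%N) (d0 : forall i, (0 < d i)%N).
Hypothesis gp : forall i, generic (p i).
Hypotheses (sH : forall i, simple_graph (H i)) (sF : simple_graph F).
Implicit Types (W : {set V}) (v : V).
Hypothesis cH : forall i, closed_in (p i) (H i).

Let K := (\sum_(i < s) d i * (d i).+1)%N.
(** The intersection makes every common clique of the [H i] a clique of [G]. *)
Let G := (\bigcap_i H i) :|: F.
Let rk i W : nat := \rank (row_span (p i) (induced (H i) W)).

Let sG : simple_graph G.
Proof. by move=> e /setUP[/bigcapP/(_ (Ordinal s0) isT)/sH|/sF]. Qed.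

Let dK i : (d i <= K)%N.
Proof. by rewrite /K (bigD1 i) //=; apply: leq_trans (leq_addr _ _); rewrite leq_pmulr. Qed.

Lemma card_nbrs_split i W v :
  (#|nbrs G W v| - #|nbrs F W v| <= #|nbrs (H i) W v|)%N.
Proof.
rewrite leq_subLR addnC; apply: leq_trans (leq_card_setU _ _).1.
apply/subset_leq_card/subsetP => x; rewrite !inE => /andP[-> /orP[/bigcapP/(_ i isT)->//|->]].
by rewrite orbT.
Qed.

(* The vertices at which the random-order bound can fail. *)
Definition inert W v := (nbrs F W v == set0) && [forall i, clique (H i) (nbrs (H i) W v)].

(** Each vertex contributes at least the sum of the [d i]; half the [F]-degrees add up to at most
    the number of [F]-edges in [W]. *)
Lemma rank_sum_no_inert W : k_connected_in G K W ->
  (forall v, v \in W -> ~~ inert W v) ->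
  \sum_i (d i * #|W|)%:R <= (#|induced F W| + \sum_i rk i W)%N%:R :> rat.
Proof.
move=> conn good.
apply: (@le_trans _ _ (\sum_(v in W) (\sum_i vertex_bound (d i) #|nbrs (H i) W v|
    (clique (H i) (nbrs (H i) W v)) + #|nbrs F W v|%:R / 2))).
  have -> : \sum_i (d i * #|W|)%:R = \sum_(v in W) \sum_i (d i)%:R :> rat.
    by rewrite sumr_const -mulr_natr mulr_suml; apply: eq_bigr => i _; rewrite natrM.
  apply: ler_sum => v vW; apply: sum_vertex_bound_ge => // [i|F0].
    apply: leq_trans (card_nbrs_split i W v).
    by rewrite leq_sub2r // (k_connected_in_nbrs sG conn).
  apply/existsP; rewrite -negb_forall; apply: contra (good v vW) => cl.
  by rewrite /inert -cards_eq0 F0 eqxx.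
rewrite big_split /= natrD addrC lerD //.
  rewrite -mulr_suml -natr_sum ler_pdivrMr ?ltr0n // -natrM ler_nat mulnC.
  exact: sum_card_nbrs.
rewrite exchange_big natr_sum; apply: ler_sum => i _.
exact: rank_induced_ge.
Qed.

(** The base case: the loss [triang (d i) / (K + 1)] occurs at each of the [K + 1] vertices. *)
Lemma rank_sum_complete W : #|W| = K.+1 -> (forall i, clique (H i) W) ->
  \sum_i ((d i * #|W|)%:R - triang (d i)) <= (#|induced F W| + \sum_i rk i W)%N%:R :> rat.
Proof.
move=> WK cl; apply: (@le_trans _ _ (\sum_i rk i W)%N%:R); last by rewrite ler_nat leq_addl.
rewrite natr_sum; apply: ler_sum => i _.
apply: le_trans (rank_induced_ge (d0 i) (@gp i) (@sH i) (@cH i) W).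
have nbE v : v \in W -> nbrs (H i) W v = W :\ v.
  move=> vW; apply/setP => x; rewrite !inE andbC; have [->|xv] := eqVneq x v.
    by rewrite simple_loop.
  case xW: (x \in W); rewrite ?andbF //= andbT; apply/idP.
  by apply: (elimT (cliqueP _ _) (cl i)) => //; rewrite eq_sym.
have cK v : v \in W -> #|W :\ v| = K.
  by move=> vW; move: WK; rewrite (cardsD1 v) vW => -[].
rewrite (eq_bigr (fun=> (d i)%:R - triang (d i) / K.+1%:R)).
  rewrite sumr_const WK -[(_ - _) *+ _]mulr_natr mulrBl divfK ?pnatr_eq0 // natrM; exact: lexx.
move=> v vW; rewrite nbE // cK // (clique_sub (subD1set _ _) (cl i)).
exact: vertex_bound_clique.
Qed.

Lemma rank_sum_ge W : k_connected_in G K W ->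
  \sum_i ((d i * #|W|)%:R - triang (d i)) <= (#|induced F W| + \sum_i rk i W)%N%:R :> rat.
Proof.
elim: {W}_.+1 {-2}W (ltnSn #|W|) => // n IHn W Wn conn.
have [good|] := boolP [forall v in W, ~~ inert W v].
  apply: le_trans (rank_sum_no_inert conn (elimT forall_inP good)).
  by apply: ler_sum => i _; rewrite gerBl divr_ge0 ?ler0n.
(* An inert [v] has no [F]-edge in [W], so its [G]-neighbours form a clique in each [H i]. *)
case/forall_inPn => v vW; rewrite negbK => /andP[/eqP F0 /forallP cl].
have NH i : nbrs G W v \subset nbrs (H i) W v.
  apply/subsetP => x xN; case/nbrsP: (xN) => xW /setUP[/bigcapP vx|vx].
    by apply/nbrsP; split=> //; apply: vx.
  by have : x \in nbrs F W v; [apply/nbrsP|rewrite F0 inE].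
have clG i : clique (H i) (nbrs G W v) by apply: clique_sub (NH i) (cl i).
have KN := k_connected_in_nbrs sG conn vW.
have NW : nbrs G W v \subset W :\ v.
  apply/subsetP => x xN; rewrite in_setD1; case/nbrsP: (xN) => -> _.
  by rewrite andbT; apply: contraTneq xN => ->; apply: nbrs_self.
have cW : #|W| = #|W :\ v|.+1 by rewrite (cardsD1 v) vW.
(* If [W :\ v] has at most [K] vertices, they are all neighbours of [v], and [W] is complete in
   every [H i]. *)
have [KW|WK] := ltnP K #|W :\ v|; last first.
  have cWK : #|W| = K.+1.
    by apply/eqP; rewrite cW eqSS eqn_leq WK (leq_trans KN) // subset_leq_card.
  apply: rank_sum_complete => // i.
  have NE : nbrs G W v = W :\ v.
    by apply/eqP; rewrite eqEcard NW (leq_trans WK).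
  have vx x : x \in W -> x != v -> [set v; x] \in H i.
    move=> xW xv; have /(subsetP (NH i))/nbrsP[] // : x \in nbrs G W v.
    by rewrite NE !inE xv.
  apply/cliqueP => a b aW bW ab.
  have [av|av] := eqVneq a v; first by rewrite av vx // -av eq_sym.
  have [bv|bv] := eqVneq b v; first by rewrite bv setUC vx.
  by apply: (elimT (cliqueP _ _) (clG i)); rewrite ?NE ?inE ?av ?bv.
have conn' : k_connected_in G K (W :\ v).
  apply: k_connected_in_setD1 => //; apply/cliqueP => a b aN bN ab.
  apply/setUP; left; apply/bigcapP => i _.
  by apply: (elimT (cliqueP _ _) (clG i)).
have {IHn} := IHn (W :\ v) _ conn'; rewrite -ltnS -cW => /(_ Wn) IH.
(* Removing [v] lowers the target by the sum of the [d i], and each rank by at least [d i], as [v]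
   has at least [K >= d i] neighbours. *)
apply: (@le_trans _ _ ((#|induced F (W :\ v)| + \sum_i rk i (W :\ v))%N%:R + \sum_i (d i)%:R)).
  rewrite -lerBlDr -sumrB; apply: le_trans IH; apply: ler_sum => i _.
  by rewrite cW mulnSr natrD addrAC addrK.
rewrite -natr_sum -natrD ler_nat -addnA -big_split leq_add //=.
  exact/subset_leq_card/inducedS/subD1set.
apply: leq_sum => i _; rewrite /rk -{2}(setD1K vW).
have vP : v \notin W :\ v by rewrite !inE eqxx.
apply: leq_trans (rank_add_vertex (H i) (@gp i) vP); rewrite leq_add2l.
rewrite leq_min leqnn (nbrs_setD1_self (@sH i)) (leq_trans (dK i)) //.
exact: leq_trans KN (subset_leq_card (NH i)).
Qed.

End Main.

(** * Application to the closures *)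

Lemma triang_bin d : triang d = 'C(d.+1, 2)%:R.
Proof.
apply: (canLR (mulfK _)); rewrite ?pnatr_eq0 // -natrM.
congr (_%:R); have := bin_ffact d.+1 2; rewrite ffactnS ffactn1 => e.
by rewrite mulnC -e; congr (_ * _)%N.
Qed.

Theorem theorem1p6 (R : realType) (V : finType) (s : nat) (d : 'I_s -> nat)
    (EH EF : {set {set V}}) :
  (1 <= s)%N ->
  (forall i, (0 < d i)%N) ->
  simple_graph EH ->
  simple_graph EF ->
  [disjoint EH & EF] ->
  k_connected (\sum_(i < s) d i * (d i).+1)%N (EH :|: EF) ->
  \sum_(i < s) (((d i * #|V|)%N)%:Z - ('C((d i).+1, 2))%:Z)
    <= (#|EF| + \sum_(i < s) rigidity_rank R (d i) EH)%N%:Z.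
Proof.
move=> s0 d0 sH sF _ [KV conn].
pose p i := projT1 (cid (generic_exists R V (d i))).
have gp i : generic (p i) by rewrite /p; case: cid.
have indT (E : {set {set V}}) : induced E setT = E.
  by apply/setP => e; rewrite inE subsetT andbT.
have := @rank_sum_ge R V s d p (fun i => row_closure (p i) EH) EF s0 d0 gp
  (fun i => @simple_row_closure _ _ _ _ _) sF (fun i => @closed_in_row_closure _ _ _ _ _) setT.
rewrite cardsT indT => main; rewrite -(ler_int rat) -pmulrn rmorph_sum /=.
under eq_bigr do rewrite rmorphB /= -!pmulrn -triang_bin.
apply: le_trans (main _) _.
  split=> [|S Sk]; first by rewrite cardsT.
  rewrite setIT in Sk; rewrite setCT setU0.
  (* Passing to closures only adds edges, so connectivity persists. *)
  have sub u v : connect (adj_avoiding (EH :|: EF) S) u v ->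
      connect (adj_avoiding (\bigcap_i row_closure (p i) EH :|: EF) S) u v.
    apply: connect_sub => x y /and3P[xS yS xy]; apply: connect1.
    rewrite /adj_avoiding /= xS yS /= inE; case/setUP: xy => [xy|->]; last by rewrite orbT.
    by apply/orP; left; apply/bigcapP => i _; apply: (subsetP (sub_row_closure _ sH)).
  by move=> u v uS vS; apply/sub/conn.
(* Passing to closures does not increase the ranks. *)
rewrite ler_nat leq_add2l; apply: leq_sum => i _.
by rewrite indT /rigidity_rank -rank_row_span mxrankS ?row_span_closure.
Qed.
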